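(* Let $\alpha,\beta\in\mathbb{C}$ with $\alpha\beta\neq 0$, let $\delta=-\beta^2/2$, and let $a_0$ be any cube root of $-\delta/\alpha$. Let $(a_n)_{n\ge 0}$ be the sequence of complex numbers determined by $$a_1=-\frac{\beta}{2\alpha a_0},\qquad a_2=0,\qquad a_3=-\frac{\beta}{6\alpha^2a_0^2}\left(\frac{\beta^2}{4\delta}+1\right),$$ and, for $n\ge 4$, $$a_n=\frac{1}{3\alpha a_0^2}\left(-\alpha\sum_{k=1}^{n-1}a_k\sum_{j=0}^{n-k}a_ja_{n-k-j}-\alpha a_0\sum_{k=1}^{n-1}a_ka_{n-k}-\frac32\beta a_{n-1}+\sum_{k=1}^{n-2}\bigl(2k^2+k(2-n)\bigr)a_ka_{n-2-k}\right).$$ Then the series $\sum_{n=0}^\infty a_nx^{-n}$ diverges.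
   Context: ''The series diverges'' means that, as a power series in $x^{-1}$, it has radius of convergence zero, i.e. it diverges for every $x\in\mathbb{C}\setminus\{0\}$. Background (not needed to understand the claim): the series $\sum a_n x^{-n}$ are exactly the formal power series in $x^{-1}$ satisfying $u''=\frac{(u')^2}{u}-\frac{u'}{x}+\alpha u^2+\frac{3}{2}\frac{\beta}{x}+\frac{\delta}{u}$, which is obtained from the third Painlevé equation with $\gamma=0$ by the substitution $w(z)=z^{1/3}u(x)$, $x=\frac32 z^{2/3}$. *)

(* Defs.v *)
From HB Require Import structures.
From mathcomp Require Import all_boot all_order all_algebra.
From mathcomp Require Import all_classical all_reals all_analysis.
From mathcomp Require Export complex.

Set Implicit Arguments.
Unset Strict Implicit.
Unset Printing Implicit Defensive.

Import Order.TTheory GRing.Theory Num.Theory numFieldNormedType.Exports.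

Local Open Scope classical_set_scope.
Local Open Scope ring_scope.

(* [R[i]] itself carries no topology.  The alias [(R[i] : numFieldType)^o] is
   the same type, viewed as a normed space over itself whose norm is the
   complex modulus, so that [cvgn] below is convergence of the partial sums
   to a complex limit in the usual topology. *)
Definition cvg_complex_series (R : realType) (u : nat -> R[i]) : Prop :=
  cvgn (series u : nat -> (R[i] : numFieldType)^o).

(* Main.v *)
Require Import Defs.
From HB Require Import structures.
From mathcomp Require Import all_boot all_order all_algebra.
From mathcomp Require Import all_classical all_reals all_analysis.
From mathcomp Require Import ring lra zify.

(** Write [theta] for [s d/ds].  Because [delta = - beta^2 / 2], the scaling
    [a_n = a_0 * g^n * w_n] with [g = beta / (2 alpha a_0^2)] removes all the
    parameters at once ([normalized_painleve]): the series [w = sum w_n s^n]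
    is the solution of
      [2 s^2 (w theta^2 w - (theta w)^2) = w^3 + 3 s w - 1]
    with [w = 1 - s + O(s^3)].  Its coefficients are rational numbers, and
    divergence becomes a statement about a single real sequence.  Put
    [w = 1 - s - h], so that [h = s^3 / 3 + s^4 / 3 + 2 s^5 + ...].  It is
    enough to show that [h_n > 0] for [n >= 3] and that [h_n / h_(n-2)] tends to infinity
    ([coef_growth]): then [h_n r^n] tends to [0] for no [r > 0]
    ([geometric_increasing]), whereas the terms of a convergent series do.

    The linear part of the equation suggests [3 h_n ~ 2 (n-2)^2 h_(n-2)].  The
    point of the proof is to measure the defect of this by the series
      [e = 3 h + 3 s^2 h - 2 s^2 theta^2 h],
    that is, [e_n = 3 h_n - (2 (n-2)^2 - 3) h_(n-2)], and to prove
    [e_n >= 0].  Rewritten with [e], the equation is ([painleve_excess])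
      [e = s e + s^3 (4 theta - 5) h + s^3 + h e
           + (2 s^2 (theta h)^2 - 3 s^2 h^2) - 3 s h^2 - h^3].
    The large negative terms of the original equation, those with
    [h theta^2 h], have disappeared.  The parenthesis has nonnegative
    coefficients, and the other negative terms contain no derivative and are
    dominated by [s^3 (4 theta - 5) h] as soon as products [h_k h_l] are known
    to be at most [h_(k+l-3) / 3].  This last inequality ([coef_pair]) holds
    because a product does not decrease when its smaller index is lowered by 2
    and its larger one raised by 2, which follows from [e_n >= 0] together
    with an upper bound [e_n = O(n h_(n-2))].  Hence a simultaneous induction
    ([growth_stepS]) on three facts: [e_n >= e_(n-1)], the upper bound on
    [e_n], and [h_n >= 2 h_(n-1)].  It starts from the values of
    [h_3, ..., h_6]. *)

Set Implicit Arguments.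
Unset Strict Implicit.
Unset Printing Implicit Defensive.

Import Order.TTheory GRing.Theory Num.Theory.

Local Open Scope ring_scope.

Local Notation "n .+5" := n.+4.+1
  (at level 1, left associativity, format "n .+5") : nat_scope.
Local Notation "n .+6" := n.+4.+2
  (at level 1, left associativity, format "n .+6") : nat_scope.

(** * Coefficient form of the differential equation *)

Section Equation.
Variable F : fieldType.
Implicit Types f g h w : nat -> F.

Definition cauchy f g (n : nat) : F := \sum_(k < n.+1) f k * g (n - k)%N.

(** The coefficients of [s f'(s)]. *)
Definition euler f (n : nat) : F := n%:R * f n.

(** The coefficients of [3 h + 3 s^2 h - 2 s^2 theta^2 h].  The summand
    [3 s^2 h] comes from the linear part of [w^3 + 3 s w]; keeping it here
    leaves no negative multiple of [h_(n-2)] in the recursion for the excess. *)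
Definition excess h (n : nat) : F :=
  3 * h n - (if n is m.+2 then (2 * m%:R ^+ 2 - 3) * h m else 0).

(** The coefficient of [s^(n+3)] in
    [e = s e + s^3 (4 theta - 5) h + s^3 + h e + 2 s^2 (theta h)^2
         - 3 s^2 h^2 - 3 s h^2 - h^3]. *)
Definition excess_eq h (n : nat) : Prop :=
  excess h n.+3 = excess h n.+2 + (4 * n%:R - 5) * h n + (n == 0%N)%:R
    + cauchy h (excess h) n.+3 + 2 * cauchy (euler h) (euler h) n.+1
    - 3 * cauchy h h n.+1 - 3 * cauchy h h n.+2 - cauchy h (cauchy h h) n.+3.

(** The coefficient of [s^(n+3)] in
    [w^3 + 3 s w - 1 = 2 s^2 ((theta^2 w) w - (theta w)^2)]. *)
Definition painleve_eq w (n : nat) : Prop :=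
  cauchy w (cauchy w w) n.+3 + 3 * w n.+2
  = 2 * (cauchy (euler (euler w)) w n.+1 - cauchy (euler w) (euler w) n.+1).

Definition trunc N f : {poly F} := \poly_(i < N.+1) f i.

Lemma coef_trunc N f n : (n <= N)%N -> (trunc N f)`_n = f n.
Proof. by move=> nN; rewrite coef_poly ltnS nN. Qed.

Lemma coef_cauchy (p q : {poly F}) f g n :
  (forall i, (i <= n)%N -> p`_i = f i) -> (forall i, (i <= n)%N -> q`_i = g i) ->
  (p * q)`_n = cauchy f g n.
Proof.
move=> pf qg; rewrite coefM; apply: eq_bigr => i _.
by rewrite pf ?qg ?leq_subr // -ltnS.
Qed.

(** Both equations are the same polynomial identity after the substitution
    [w = 1 - s - h].  The identity is checked in [{poly F}] on truncations at an order
    high enough not to affect the coefficient of [s^(n+3)]. *)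
Lemma painleve_excess (w h : nat -> F) n :
  (forall i, w i = (i == 0%N)%:R - (i == 1%N)%:R - h i) ->
  painleve_eq w n -> excess_eq h n.
Proof.
move=> wE weq; pose N := n.+3.
pose P := trunc N h; pose P1 := trunc N (euler h).
pose P2 := trunc N (euler (euler h)).
pose W := 1 - 'X - P; pose W1 := - 'X - P1; pose W2 := - 'X - P2.
pose E := 3%:P * P + 3%:P * ('X * ('X * P)) - 2%:P * ('X * ('X * P2)).
have cP i : (i <= N)%N -> P`_i = h i by apply: coef_trunc.
have cP1 i : (i <= N)%N -> P1`_i = euler h i by apply: coef_trunc.
have cP2 i : (i <= N)%N -> P2`_i = euler (euler h) i by apply: coef_trunc.
have cW i : (i <= N)%N -> W`_i = w i.
  by move=> iN; rewrite !coefB cP // coef1 coefX wE.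
have cW1 i : (i <= N)%N -> W1`_i = euler w i.
  move=> iN; rewrite !coefB cP1 // coefN coefX /euler wE.
  by case: i iN => [|[|i]] _ //=; rewrite ?mulr1n ?mulr0n; ring.
have cW2 i : (i <= N)%N -> W2`_i = euler (euler w) i.
  move=> iN; rewrite !coefB cP2 // coefN coefX /euler wE.
  by case: i iN => [|[|i]] _ //=; rewrite ?mulr1n ?mulr0n; ring.
have cE i : (i <= N)%N -> E`_i = excess h i.
  move=> iN; rewrite /E coefB coefD !coefCM !coefXM /excess cP //.
  case: i iN => [|[|i]] iN //=; rewrite ?coefXM /= ?mulr0 ?addr0 ?subr0 //.
  by rewrite cP ?cP2 /euler; [ring | lia..].
have id : W * (W * W) + 3%:P * ('X * W) - 1
    - 2%:P * ('X * ('X * (W2 * W - W1 * W1)))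
  = - (E - ('X * E + ('X * ('X * ('X * (4%:P * P1 - 5%:P * P + 1))))
       + P * E + 2%:P * ('X * ('X * (P1 * P1))) - 3%:P * ('X * ('X * (P * P)))
       - 3%:P * ('X * (P * P)) - P * (P * P))).
  rewrite /W /W1 /W2 /E ?polyC_natr; ring.
have cM (p q : {poly F}) f g m : (m <= N)%N ->
    (forall i, (i <= N)%N -> p`_i = f i) ->
    (forall i, (i <= N)%N -> q`_i = g i) -> (p * q)`_m = cauchy f g m.
  by move=> mN pf qg; apply: coef_cauchy => i im; [apply: pf | apply: qg]; lia.
clearbody E W W1 W2 P P1 P2.
have cWWW : (W * (W * W))`_n.+3 = cauchy w (cauchy w w) n.+3.
  by apply: (cM) => // i iN; apply: (cM).
have cPPP : (P * (P * P))`_n.+3 = cauchy h (cauchy h h) n.+3.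
  by apply: (cM) => // i iN; apply: (cM).
have le1 : (n.+1 <= N)%N by rewrite /N; lia.
have le2 : (n.+2 <= N)%N by rewrite /N; lia.
have le0 : (n <= N)%N by rewrite /N; lia.
move/(congr1 (fun p : {poly F} => p`_n.+3)): id.
rewrite !(coefB, coefD, coefN, coefCM, coefXM, coef1) /= cWWW cPPP.
rewrite (cM W2 W _ _ n.+1 le1 cW2 cW) (cM W1 W1 _ _ n.+1 le1 cW1 cW1).
rewrite (cM P E _ _ n.+3 _ cP cE) // (cM P1 P1 _ _ n.+1 le1 cP1 cP1).
rewrite (cM P P _ _ n.+1 le1 cP cP) (cM P P _ _ n.+2 le2 cP cP).
rewrite cW ?cE ?cP1 ?cP // weq subr0 subrr => /esym/eqP.
rewrite oppr_eq0 subr_eq0 /excess_eq => /eqP ->.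
rewrite {1}/euler; ring.
Qed.
End Equation.

(** * Positivity and growth of the normalized coefficients *)

Section Tails.
Variable R : realFieldType.
Implicit Types f g : nat -> R.

Lemma cauchy_small f g n : (forall i, (i < 3)%N -> f i = 0) ->
  (forall i, (i < 3)%N -> g i = 0) -> (n < 6)%N -> cauchy f g n = 0.
Proof.
move=> f0 g0 n6; rewrite /cauchy big1 // => k _.
by case: (ltnP k 3) => k3; [rewrite f0 ?mul0r | rewrite g0 ?mulr0 //; lia].
Qed.

Lemma cauchy_tail f g n : (forall i, (i < 3)%N -> f i = 0) ->
  (forall i, (i < 3)%N -> g i = 0) ->
  cauchy f g n.+6 = \sum_(k < n.+1) f k.+3 * g (n - k).+3.
Proof.
move=> f0 g0.
rewrite /cauchy -(big_mkord xpredT (fun k => f k * g (n.+6 - k)%N)).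
do 3![rewrite big_nat_recl //]; do 3![rewrite big_nat_recr //=].
rewrite (f0 0%N) // (f0 1%N) // (f0 2%N) //.
rewrite (g0 (n.+6 - n.+4)%N) ?(g0 (n.+6 - n.+5)%N) ?(g0 (n.+6 - n.+6)%N);
  [|lia..].
rewrite !mul0r !mulr0 !add0r !addr0 big_mkord; apply: eq_bigr => i _.
by congr (_ * g _); have := ltn_ord i; lia.
Qed.

Lemma ler_sum_const n (F : 'I_n -> R) c :
  (forall i, F i <= c) -> \sum_(i < n) F i <= n%:R * c.
Proof.
move=> Fc; apply: (le_trans (ler_sum _ (fun i _ => Fc i))).
by rewrite sumr_const card_ord mulr_natl.
Qed.
End Tails.

Section Growth.
Variables (R : realFieldType) (h : nat -> R).
Hypothesis h_lt3 : forall i, (i < 3)%N -> h i = 0.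
Hypothesis hE : forall n, excess_eq h n.

Lemma excess_lt3 i : (i < 3)%N -> excess h i = 0.
Proof.
case: i => [|[|[|//]]] _ /=;
by rewrite /excess ?h_lt3 // !mulr0 subr0.
Qed.

(** The induction hypothesis.  The factor [8 n + 32] is
    [2 (n+5)^2 - 2 (n+3)^2]: with it, the upper bound on the excess reads
    [3 h_(n+5) <= (2 (n+5)^2 - 3) h_(n+3)], which is what [coef_pair] needs.
    The last clause lets a multiple of [h_(n+4)] be exchanged for half that
    multiple of [h_(n+5)] when the upper bound is propagated. *)
Definition growth_step n : Prop :=
  [/\ 0 < h n.+5, excess h n.+4 <= excess h n.+5,
      excess h n.+5 <= (8 * n%:R + 32) * h n.+3 & 2 * h n.+4 <= h n.+5].

Let h0 : h 0 = 0. Proof. exact: h_lt3. Qed.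
Let h1 : h 1 = 0. Proof. exact: h_lt3. Qed.
Let h2 : h 2 = 0. Proof. exact: h_lt3. Qed.

Lemma excess3 : excess h 3 = 1.
Proof.
by rewrite hE /cauchy /euler /excess !big_ord_recr !big_ord0 /= h0 h1 h2; lra.
Qed.

Lemma coef3 : h 3 = 1 / 3.
Proof. by have := excess3; rewrite /excess h1; lra. Qed.

Lemma excess4 : excess h 4 = 1.
Proof.
rewrite hE excess3 /cauchy /euler /excess !big_ord_recr !big_ord0 /= h0 h1 h2.
by rewrite ?(h0, h1, h2); lra.
Qed.

Lemma coef4 : h 4 = 1 / 3.
Proof. by have := excess4; rewrite /excess h2; lra. Qed.

Lemma excess5 : excess h 5 = 1.
Proof.
rewrite hE excess4 /cauchy /euler /excess !big_ord_recr !big_ord0 /= h0 h1 h2.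
by rewrite ?(h0, h1, h2); lra.
Qed.

Lemma coef5 : h 5 = 2.
Proof. by have := excess5; rewrite /excess coef3; lra. Qed.

Lemma excess6 : excess h 6 = 11 / 3.
Proof.
rewrite hE excess5 /cauchy /euler /excess !big_ord_recr !big_ord0 /= h0 h1 h2.
by rewrite ?(h0, h1, h2) coef3; lra.
Qed.

Lemma coef6 : h 6 = 40 / 9.
Proof. by have := excess6; rewrite /excess coef4; lra. Qed.

Section Induction.
Variable N : nat.
Hypothesis IH : forall k, (k < N)%N -> growth_step k.

Lemma coef_gt0 m : (m < N.+2)%N -> 0 < h m.+3.
Proof.
case: m => [|[|m]] mN; first by rewrite coef3; lra.
  by rewrite coef4; lra.
by case: (IH (k := m)).
Qed.

Lemma coef_ge0 m : (m < N.+5)%N -> 0 <= h m.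
Proof.
by case: m => [|[|[|m]]] mN; rewrite ?h0 ?h1 ?h2 //; apply/ltW/coef_gt0; lia.
Qed.

Lemma coef_mono m : (m < N.+1)%N -> h m.+3 <= h m.+4.
Proof.
case: m => [|m] mN; first by rewrite coef3 coef4.
have [_ _ _ H] := IH (k := m) mN; apply: le_trans H.
have := @coef_gt0 m.+1 ltac:(lia); lra.
Qed.

Lemma excess_ge1 m : (m < N.+2)%N -> 1 <= excess h m.+3.
Proof.
elim: m => [|[|m] IHm] mN; rewrite ?excess3 ?excess4 //.
have [_ H _ _] := IH (k := m) ltac:(lia).
by apply: le_trans H; apply: IHm; lia.
Qed.

Lemma coef_lower m : (m < N)%N -> (2 * m.+3%:R ^+ 2 - 3) * h m.+3 <= 3 * h m.+5.
Proof.
by move=> mN; have := @excess_ge1 m.+2 ltac:(lia); rewrite /excess; lra.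
Qed.

Lemma coef_upper m : (m < N)%N -> 3 * h m.+5 <= (2 * m.+5%:R ^+ 2 - 3) * h m.+3.
Proof.
move=> mN; have [_ _ + _] := IH mN; rewrite /excess.
have -> : m.+5%:R = m.+3%:R + 2 :> R by rewrite -natrD addn2.
have -> : m.+3%:R = m%:R + 3 :> R by rewrite -natrD addn3.
lra.
Qed.

(** For [5 <= i <= j], the upper bound on [h_i / h_(i-2)] is at most the lower
    bound on [h_(j+2) / h_j], so [h_i h_j <= h_(i-2) h_(j+2)].  Repeating this
    brings the smaller index down to 3 or 4, where [h_3 = h_4 = 1 / 3]. *)
Lemma coef_pair k l : (k + l < N.+2)%N -> h k.+3 * h l.+3 <= h (k + l).+3 / 3.
Proof.
wlog kl : k l / (k <= l)%N.
  move=> H ltN; case: (leqP k l) => [kl|/ltnW kl]; first exact: H.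
  by rewrite mulrC addnC; apply: H => //; rewrite addnC.
elim/ltn_ind: k l kl => -[|[|k]] IHk l kl ltN.
- by rewrite coef3; lra.
- have := @coef_mono l ltac:(lia); rewrite coef4 add1n; lra.
have := IHk k ltac:(lia) l.+2 ltac:(lia) ltac:(lia).
rewrite addnS addnS -addSn -addSn; apply: le_trans.
have hk := @coef_upper k ltac:(lia); have hl := @coef_lower l ltac:(lia).
have hk0 := @coef_gt0 k ltac:(lia); have hl0 := @coef_gt0 l ltac:(lia).
have kl3 : k.+2.+3%:R ^+ 2 <= l.+3%:R ^+ 2 :> R.
  by rewrite -!natrX ler_nat leq_exp2r //; lia.
suff : 3 * h k.+5 * h l.+3 <= h k.+3 * (3 * h l.+5) by lra.
apply: (le_trans (ler_wpM2r (ltW hl0) hk)).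
rewrite -mulrA mulrCA; apply: ler_wpM2l; first exact: ltW.
by apply: le_trans hl; apply: ler_wpM2r; [exact: ltW|lra].
Qed.

Lemma sqr_le q : (q < N.+2)%N -> cauchy h h q.+6 <= q.+1%:R * (h q.+3 / 3).
Proof.
move=> qN; rewrite cauchy_tail //; apply: ler_sum_const => k.
have kq := ltn_ord k; have := @coef_pair k (q - k)%N.
by rewrite subnKC; [apply; lia | lia].
Qed.

Lemma sqr_ge0 n : (n < N.+5)%N -> 0 <= cauchy h h n.
Proof.
move=> nN; apply: sumr_ge0 => k _.
by have kn := ltn_ord k; apply: mulr_ge0; apply: coef_ge0; lia.
Qed.

(** The square of [h] has at most [n - 4] terms in degree [n + 1], each at most
    [h_(n-2) / 3], and [h_n] exceeds [h_(n-2)] by a quadratic factor. *)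
Lemma sqr_le_pred n : (n < N.+4)%N -> cauchy h h n.+1 <= h n.
Proof.
move=> nN; case: (ltnP n 5) => n5.
  by rewrite cauchy_small // coef_ge0 //; lia.
have [q nE] : exists q, n = q.+5 by exists (n - 5)%N; lia.
subst n; apply: (le_trans (@sqr_le q ltac:(lia))).
case: (ltnP q N) => qN; last by lia.
have := coef_lower qN; have := @coef_gt0 q ltac:(lia).
rewrite -(addn3 q) -(addn1 q) !natrD.
have : 0 <= q%:R :> R by []. nra.
Qed.

End Induction.

(** The lemmas of this section bound the terms of the recursion in degree
    [p + 7] by multiples of [h_(p+4)], because the only term available to
    compensate the negative ones is [(4 p + 11) h_(p+4)]. *)
Section Step.
Variable p : nat.
Hypothesis IH : forall k, (k < p.+2)%N -> growth_step k.

(** The products of [h_(p+4)] and [h_(p+3)] with [e_3 = e_4 = 1] contribute at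
    most [2 h_(p+4)]; for the others, the bound [e_i = O(i h_(i-2))] and
    [coef_pair] give [O(p^2) h_(p+2)], which the quadratic growth from
    [h_(p+2)] to [h_(p+4)] turns into [4 h_(p+4)]. *)
Lemma mul_excess_bounds :
  0 <= cauchy h (excess h) p.+1.+6 <= 6 * h p.+4.
Proof.
rewrite cauchy_tail //; last exact: excess_lt3.
apply/andP; split.
  apply: sumr_ge0 => k _; have kp := ltn_ord k.
  apply: mulr_ge0; first by apply: (coef_ge0 IH); lia.
  by apply: le_trans (excess_ge1 IH _) => //; lia.
rewrite 2!big_ord_recr /= subnn subSnn excess3 excess4 !mulr1.
have m3 := coef_mono IH (m := p) ltac:(lia).
suff : \sum_(i < p) h i.+3 * excess h (p.+1 - i).+3 <= 4 * h p.+4 by lra.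
case: p IH => [|q] IH'.
  by rewrite big_ord0; have := coef_gt0 IH' (m := 1) ltac:(lia); lra.
have hq := coef_gt0 IH' (m := q) ltac:(lia).
apply: (le_trans (y := q.+1%:R * ((8 * q%:R + 32) * (h q.+3 / 3)))).
  apply: ler_sum_const => k; have kq := ltn_ord k.
  have -> : (q.+2 - k).+3 = (q - k).+5 by lia.
  have [_ _ Ek _] := IH' (q - k)%N ltac:(lia).
  have hk := coef_gt0 IH' (m := k) ltac:(lia).
  apply: (le_trans (ler_wpM2l (ltW hk) Ek)); rewrite mulrCA.
  apply: ler_pM.
  - by apply: addr_ge0 => //; apply: mulr_ge0.
  - by apply: mulr_ge0; [exact: ltW | apply/ltW/(coef_gt0 IH'); lia].
  - by rewrite lerD2r ler_pM2l // ler_nat leq_subr.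
  - have := coef_pair IH' (k := k) (l := (q - k)%N).
    by rewrite subnKC; [apply; lia | lia].
have := coef_lower IH' (m := q) ltac:(lia).
rewrite -(addn3 q) -(addn1 q) !natrD in hq *.
have : 0 <= q%:R :> R by []. nra.
Qed.

(** This difference is the sum of [(2 k l - 3) h_k h_l] over [k + l = p + 5],
    where [h_k h_l] vanishes unless [k, l >= 3]. *)
Lemma euler_sqr_bounds :
  0 <= 2 * cauchy (euler h) (euler h) p.+5 - 3 * cauchy h h p.+5
    <= (p%:R + 7) * h p.+4.
Proof.
have eu0 i : (i < 3)%N -> euler h i = 0.
  by move=> i3; rewrite /euler h_lt3 // mulr0.
case: p IH => [|q] IH'.
  rewrite !cauchy_small // !mulr0 subrr lexx /=.
  by have := coef_gt0 IH' (m := 1) ltac:(lia); lra.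
rewrite !cauchy_tail // !mulr_sumr -sumrB.
have -> : \sum_(i < q.+1) (2 * (euler h i.+3 * euler h (q - i).+3)
    - 3 * (h i.+3 * h (q - i).+3))
  = \sum_(i < q.+1) (2 * i.+3%:R * (q - i).+3%:R - 3) * (h i.+3 * h (q - i).+3).
  by apply: eq_bigr => i _; rewrite /euler; ring.
have hq := coef_gt0 IH' (m := q) ltac:(lia).
apply/andP; split.
  apply: sumr_ge0 => i _; have iq := ltn_ord i.
  apply: mulr_ge0.
    rewrite -(addn3 i) -(addn3 (q - i)) !natrD.
    have : 0 <= i%:R :> R by []. have : 0 <= (q - i)%:R :> R by []. nra.
  by apply: mulr_ge0; apply: (coef_ge0 IH'); lia.
apply: (le_trans (y := q.+1%:R * ((2 * q.+3%:R ^+ 2 - 3) * (h q.+3 / 3)))).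
  apply: ler_sum_const => i; have iq := ltn_ord i.
  have i0 : 0 <= i%:R :> R by [].
  have j0 : 0 <= (q - i)%:R :> R by [].
  have qE : q%:R = i%:R + (q - i)%:R :> R by rewrite -natrD subnKC //; lia.
  apply: ler_pM.
  - rewrite -(addn3 i) -(addn3 (q - i)) !natrD; nra.
  - by apply: mulr_ge0; apply: (coef_ge0 IH'); lia.
  - rewrite -(addn3 i) -(addn3 (q - i)) -(addn3 q) !natrD qE; nra.
  - have := coef_pair IH' (k := i) (l := (q - i)%N).
    by rewrite subnKC; [apply; lia | lia].
have low := coef_lower IH' (m := q) ltac:(lia).
have h5 := coef_gt0 IH' (m := q.+2) ltac:(lia).
apply: (le_trans (y := q.+1%:R * h q.+5)).
  by apply: ler_wpM2l => //; lra.
by apply: ler_wpM2r; [exact: ltW | rewrite -(addn1 q) natrD; lra].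
Qed.

(** By [sqr_le_pred], the factor [h^2] may be replaced by [s h]. *)
Lemma cube_bounds :
  0 <= cauchy h (cauchy h h) p.+1.+6 <= cauchy h h p.+6.
Proof.
rewrite {1 3}/cauchy big_ord_recr /= subnn {2 4}/cauchy big_ord1 h0 !mulr0 addr0.
apply/andP; split; [apply: sumr_ge0 | apply: ler_sum] => k _.
  case: (ltnP k 3) => k3; first by rewrite h_lt3 ?mul0r.
  have kp := ltn_ord k.
  by apply: mulr_ge0; [apply: (coef_ge0 IH) | apply: (sqr_ge0 IH)]; lia.
case: (ltnP k 3) => k3; first by rewrite h_lt3 ?mul0r.
have kp := ltn_ord k.
apply: ler_wpM2l; first by apply: (coef_ge0 IH); lia.
by rewrite subSn; [apply: (sqr_le_pred IH); lia | lia].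
Qed.

(** With [n = p + 7], the estimates above give
    [(8 p + 29) / 3 * h_(n-3) <= e_n - e_(n-1) <= (5 p + 24) h_(n-3)].  The
    right half and [e_(n-1) <= (8 p + 40) h_(n-3)] bound [e_n] through
    [2 h_(n-3) <= h_(n-2)].  In [h_n - 2 h_(n-1)], the unwanted [- e_(n-1)] is
    compensated by the increase of the quadratic factor from [n - 1] to [n]. *)
Lemma growth_stepS : growth_step p.+2.
Proof.
have [lt_p lt_p6] : (p < p.+4)%N /\ (p.+6 < p.+2.+4.+1)%N by split; lia.
have hh := sqr_le IH lt_p; have hh0 := sqr_ge0 IH lt_p6.
have /andP[hhh0 hhh] := cube_bounds.
have h4 := coef_gt0 IH (m := p.+1) ltac:(lia).
have h34 := coef_mono IH (m := p) ltac:(lia).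
have [h5 _ _ h45] := IH (k := p) ltac:(lia).
have [h6 _ E6 h56] := IH (k := p.+1) ltac:(lia).
have /andP[E0 E1] := mul_excess_bounds; have /andP[D0 D1] := euler_sqr_bounds.
have Eq := hE p.+4; rewrite /excess_eq mulr0n addr0 in Eq.
have p0 : 0 <= p%:R :> R by [].
have p4E : p.+4%:R = p%:R + 4 :> R by rewrite -natrD addn4.
have p1E : p.+1%:R = p%:R + 1 :> R by rewrite natr1.
have p5E : p.+5%:R = p%:R + 5 :> R by rewrite -natrD addnC.
have p2E : p.+2%:R = p%:R + 2 :> R by rewrite -natrD addn2.
rewrite p4E in Eq; rewrite p1E in hh E6.
have hh' : 3 * cauchy h h p.+6 + cauchy h (cauchy h h) p.+1.+6
    <= (4 / 3 * p%:R + 4 / 3) * h p.+4.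
  have : p%:R * h p.+3 <= p%:R * h p.+4 by exact: ler_wpM2l.
  lra.
have dE : (8 / 3 * p%:R + 29 / 3) * h p.+4 <= excess h p.+1.+6 - excess h p.+6.
  lra.
have ph : 0 <= p%:R * h p.+4 by apply: mulr_ge0 => //; exact: ltW.
have ph' : 2 * (p%:R * h p.+4) <= p%:R * h p.+5.
  by rewrite mulrCA; exact: ler_wpM2l.
have h7 : 2 * h p.+6 <= h p.+1.+6.
  have e7 : excess h p.+1.+6 = 3 * h p.+1.+6 - (2 * (p%:R + 5) ^+ 2 - 3) * h p.+5.
    by rewrite /excess p5E.
  have e6 : excess h p.+6 = 3 * h p.+6 - (2 * (p%:R + 4) ^+ 2 - 3) * h p.+4.
    by rewrite /excess p4E.
  have : (2 * (p%:R + 5) ^+ 2 - 3) * (2 * h p.+4)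
      <= (2 * (p%:R + 5) ^+ 2 - 3) * h p.+5.
    by apply: ler_wpM2l => //; nra.
  lra.
split; [lra | lra | rewrite p2E; lra | exact: h7].
Qed.
End Step.

Lemma growth_stepP n : growth_step n.
Proof.
elim/ltn_ind: n => -[|[|p]] IH; last exact: growth_stepS.
- by split; rewrite ?coef5 ?coef4 ?coef3 ?excess5 ?excess4; lra.
- by split; rewrite ?coef6 ?coef5 ?coef4 ?excess6 ?excess5; lra.
Qed.

Lemma coef_growth n :
  0 < h n.+3 /\ (2 * n.+3%:R ^+ 2 - 3) * h n.+3 <= 3 * h n.+5.
Proof.
have IH N k : (k < N)%N -> growth_step k by move=> _; exact: growth_stepP.
by split; [apply: (coef_gt0 (IH n)); lia | apply: (coef_lower (IH n.+1)); lia].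
Qed.
End Growth.

(** * Complex solutions have real coefficients *)

Lemma rmorph_cauchy (K L : fieldType) (phi : {rmorphism K -> L}) (f g : nat -> K) n :
  phi (cauchy f g n) = cauchy (phi \o f) (phi \o g) n.
Proof. by rewrite /cauchy rmorph_sum; apply: eq_bigr => k _; rewrite rmorphM. Qed.

Lemma rmorph_euler (K L : fieldType) (phi : {rmorphism K -> L}) (f : nat -> K) :
  phi \o euler f = euler (phi \o f).
Proof. by apply/funext => n; rewrite /euler /= rmorphM rmorph_nat. Qed.

Lemma rmorph_excess (K L : fieldType) (phi : {rmorphism K -> L}) (f : nat -> K) n :
  phi (excess f n) = excess (phi \o f) n.
Proof.
rewrite /excess rmorphB rmorphM rmorph_nat; congr (_ - _).
case: n => [|[|n]]; rewrite ?rmorph0 //=.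
by rewrite rmorphM rmorphB rmorphM rmorphXn !rmorph_nat.
Qed.

Lemma excess_eq_rmorph (K L : fieldType) (phi : {rmorphism K -> L})
    (f : nat -> K) n :
  excess_eq (phi \o f) n -> excess_eq f n.
Proof.
have cE : phi \o excess f = excess (phi \o f).
  by apply/funext => m; rewrite /= rmorph_excess.
have cc : phi \o cauchy f f = cauchy (phi \o f) (phi \o f).
  by apply/funext => m; rewrite /= rmorph_cauchy.
move=> H; apply: (fmorph_inj phi).
rewrite rmorph_excess [LHS]H; apply/esym.
rewrite 3!rmorphB 4!rmorphD rmorph_excess 4!rmorphM.
rewrite [phi (_ * _ - _)]rmorphB rmorphM !rmorph_nat.
by rewrite !rmorph_cauchy !rmorph_euler cE cc.
Qed.

(** The recursion expresses each coefficient from the third on as a polynomial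
    in the earlier ones, with rational coefficients. *)
Lemma real_solution (R : rcfType) (H : nat -> R[i]) :
  (forall i, (i < 3)%N -> H i = 0) -> (forall n, excess_eq H n) ->
  exists h : nat -> R, H = (real_complex R) \o h.
Proof.
move=> H0 HE.
suff Hr n : H n \is Num.real.
  by exists (fun n => complex.Re (H n)); apply/funext => n; rewrite /= RRe_real.
elim/ltn_ind: n => n IH; case: (ltnP n 3) => n3; first by rewrite H0 // real0.
have [m nE] : exists m, n = m.+3 by exists (n - 3)%N; lia.
subst n.
have Er i : (i < m.+3)%N -> excess H i \is Num.real.
  move=> im; apply: rpredB; first by apply: rpredM; [exact: realn | exact: IH].
  case: i im => [|[|i]] im; rewrite ?real0 //.
  apply: rpredM; last by apply: IH; lia.
  by apply: rpredB; [apply: rpredM; [|apply: rpredX] |]; exact: realn.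
have cr (f g : nat -> R[i]) k : (k < m.+3)%N ->
    (forall i, (i < m.+3)%N -> f i \is Num.real) ->
    (forall i, (i < m.+3)%N -> g i \is Num.real) -> cauchy f g k \is Num.real.
  move=> km fr gr; apply: rpred_sum => i _; have ik := ltn_ord i.
  by apply: rpredM; [apply: fr | apply: gr]; lia.
(* The top coefficients of both factors of [cauchy H g m.+3] meet a zero. *)
have cHr (g : nat -> R[i]) : g 0%N = 0 ->
    (forall i, (i < m.+3)%N -> g i \is Num.real) -> cauchy H g m.+3 \is Num.real.
  move=> g0 gr; rewrite /cauchy big_ord_recl H0 // mul0r add0r.
  rewrite big_ord_recr /= subnn g0 mulr0 addr0.
  apply: rpred_sum => i _; have im := ltn_ord i.
  by apply: rpredM; [apply: IH | apply: gr]; rewrite /bump /=; lia.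
have e0 : excess H 0%N = 0 by rewrite /excess H0 // mulr0 subr0.
have c0 : cauchy H H 0%N = 0 by rewrite /cauchy big_ord1 H0 // mul0r.
have eur i : (i < m.+3)%N -> euler H i \is Num.real.
  by move=> im; apply: rpredM; [exact: realn | exact: IH].
have E3r : excess H m.+3 \is Num.real.
  have lin (c : R[i]) f g k : (k < m.+3)%N -> c \is Num.real ->
      (forall i, (i < m.+3)%N -> f i \is Num.real) ->
      (forall i, (i < m.+3)%N -> g i \is Num.real) ->
      c * cauchy f g k \is Num.real.
    by move=> *; apply: rpredM => //; exact: cr.
  rewrite HE; apply: rpredB; last by apply: cHr => // i im; exact: cr.
  apply: rpredB; last exact: lin.
  apply: rpredB; last exact: lin.
  apply: rpredD; last exact: lin.
  apply: rpredD; last exact: cHr.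
  apply: rpredD; last exact: realn.
  apply: rpredD; [exact: Er | apply: rpredM; last by apply: IH; lia].
  by apply: rpredB; [apply: rpredM|]; exact: realn.
have -> : H m.+3 = (excess H m.+3 + (2 * m.+1%:R ^+ 2 - 3) * H m.+1) / 3.
  by rewrite /excess; field.
apply: rpredM; last by rewrite rpredV realn.
apply: rpredD => //; apply: rpredM; last by apply: IH; lia.
by apply: rpredB; [apply: rpredM; [|apply: rpredX] |]; exact: realn.
Qed.

(** * Removing the parameters *)

Lemma cauchy_geometric (F : fieldType) (c d g : F) (f1 g1 f2 g2 : nat -> F) n :
  (forall k, f1 k = c * g ^+ k * f2 k) -> (forall k, g1 k = d * g ^+ k * g2 k) ->
  cauchy f1 g1 n = c * d * g ^+ n * cauchy f2 g2 n.
Proof.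
move=> fE gE; rewrite /cauchy mulr_sumr; apply: eq_bigr => k _.
have kn : (k <= n)%N by rewrite -ltnS.
have gn : g ^+ n = g ^+ k * g ^+ (n - k) by rewrite -exprD subnKC.
rewrite fE gE gn; ring.
Qed.

Lemma cauchy_ends (F : fieldType) (f g : nat -> F) n :
  cauchy f g n.+1 = f 0%N * g n.+1 + \sum_(1 <= k < n.+1) f k * g (n.+1 - k)%N
    + f n.+1 * g 0%N.
Proof.
rewrite /cauchy -(big_mkord xpredT (fun k => f k * g (n.+1 - k)%N)).
rewrite big_nat_recr //= big_ltn // subn0 subnn; ring.
Qed.

Section Normalization.
Variables (F : numFieldType) (alpha beta delta : F) (a : nat -> F).
Hypothesis h_alpha_beta : alpha * beta != 0.
Hypothesis h_delta : delta = - (beta ^+ 2 / 2).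
Hypothesis h_a0 : a 0%N ^+ 3 = - delta / alpha.
Hypothesis h_a1 : a 1%N = - (beta / (2 * alpha * a 0%N)).
Hypothesis h_a2 : a 2%N = 0.
Hypothesis h_a3 : a 3%N = - (beta / (6 * alpha ^+ 2 * a 0%N ^+ 2))
                    * (beta ^+ 2 / (4 * delta) + 1).
Hypothesis h_an : forall n : nat, (4 <= n)%N ->
    a n = 1 / (3 * alpha * a 0%N ^+ 2) *
      (- alpha * (\sum_(1 <= k < n)
          a k * \sum_(0 <= j < (n - k).+1) a j * a (n - k - j)%N)
       - alpha * a 0%N * (\sum_(1 <= k < n) a k * a (n - k)%N)
       - 3 / 2 * beta * a (n - 1)%N
       + \sum_(1 <= k < (n - 1)%N)
          (2 * k%:R ^+ 2 + k%:R * (2 - n%:R)) * a k * a (n - 2 - k)%N).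

Lemma alpha_neq0 : alpha != 0.
Proof. by move: h_alpha_beta; rewrite mulf_eq0 negb_or => /andP[]. Qed.

Lemma beta_neq0 : beta != 0.
Proof. by move: h_alpha_beta; rewrite mulf_eq0 negb_or => /andP[]. Qed.

(** The form in which the condition on [delta] enters. *)
Lemma a0_cube : 2 * alpha * a 0%N ^+ 3 = beta ^+ 2.
Proof. by rewrite h_a0 h_delta; field; exact: alpha_neq0. Qed.

Lemma a0_neq0 : a 0%N != 0.
Proof.
apply: contraNneq beta_neq0 => a0; move: a0_cube.
by rewrite a0 expr0n mulr0 => /esym/eqP; rewrite sqrf_eq0.
Qed.

(** With [t = 1 / x] and [theta = t d/dt], the differential equation for [u]
    becomes
    [t^2 (u theta^2 u - (theta u)^2) = alpha u^3 + 3/2 beta t u + delta];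
    the given recursion is its coefficient of [t^n], solved for [a_n]. *)
Lemma formal_solution n :
  alpha * cauchy a (cauchy a a) n.+3 + 3 / 2 * beta * a n.+2
  = cauchy (euler (euler a)) a n.+1 - cauchy (euler a) (euler a) n.+1.
Proof.
have al0 := alpha_neq0; have be0 := beta_neq0; have a0 := a0_neq0.
case: n => [|n].
  rewrite /cauchy /euler !big_ord_recr !big_ord0 /= h_a3 h_a2 h_a1 h_delta.
  have -> : alpha = beta ^+ 2 / (2 * a 0%N ^+ 3) by rewrite -a0_cube; field.
  by rewrite !(subnn, subn0); field; rewrite a0 be0.
have cE k : \sum_(0 <= j < k.+1) a j * a (k - j)%N = cauchy a a k.
  by rewrite big_mkord.
have := @h_an n.+4 isT; rewrite subn1.
under eq_bigr do rewrite cE.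
set A := (X in - alpha * X); set B := (X in _ * a 0%N * X).
set C := (X in _ + X); move=> an.
(* [k^2 - k l] with [k + l = n + 2] is the weight [2 k^2 + k (2 - (n + 4))]. *)
have CE : cauchy (euler (euler a)) a n.+2 - cauchy (euler a) (euler a) n.+2 = C.
  rewrite /cauchy -sumrB -(big_mkord xpredT (fun k =>
    euler (euler a) k * a (n.+2 - k)%N - euler a k * euler a (n.+2 - k)%N)).
  rewrite big_ltn // /euler !mul0r subrr add0r; apply: eq_big_nat => k /andP[_ kn].
  rewrite subn2 /= natrB // -(addn2 n.+2) natrD; ring.
rewrite CE cauchy_ends (cauchy_ends a a) -/A -/B /cauchy big_ord1 an.
by field; rewrite a0.
Qed.

(** The scaling for which the coefficients of [w^3] and [s w] on one side are
    1 and 3.  The coefficient on the other side is then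
    [1 / (alpha * a_0 * rate^2)], which equals 2 by [a0_cube]. *)
Definition rate : F := beta / (2 * alpha * a 0%N ^+ 2).

Definition normalized n : F := a n / (a 0%N * rate ^+ n).

Lemma rate_neq0 : rate != 0.
Proof.
by rewrite mulf_neq0 ?invr_neq0 ?mulf_neq0 ?expf_neq0 ?pnatr_eq0 ?beta_neq0
  ?alpha_neq0 ?a0_neq0.
Qed.

Lemma normalizedE n : a n = a 0%N * rate ^+ n * normalized n.
Proof.
by rewrite /normalized mulrC divfK // mulf_neq0 ?a0_neq0 ?expf_neq0 ?rate_neq0.
Qed.

Lemma normalized_painleve n : painleve_eq normalized n.
Proof.
have al0 := alpha_neq0; have be0 := beta_neq0; have a0 := a0_neq0.
have g0 := rate_neq0.
have eE f f' : (forall k, f k = a 0%N * rate ^+ k * f' k) ->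
    forall k, euler f k = a 0%N * rate ^+ k * euler f' k.
  by move=> fE k; rewrite /euler fE; ring.
have e1 := eE _ _ normalizedE; have e2 := eE _ _ e1.
have := formal_solution n.
rewrite (cauchy_geometric _ e2 normalizedE) (cauchy_geometric _ e1 e1).
rewrite (cauchy_geometric _ normalizedE
  (fun k => cauchy_geometric k normalizedE normalizedE)).
rewrite /painleve_eq (normalizedE n.+2) !exprS.
set c := cauchy _ _ n.+3; set d1 := cauchy _ _ n.+1; set d2 := cauchy _ _ n.+1.
set w := normalized n.+2.
have rb : beta = 2 * alpha * a 0%N ^+ 2 * rate by rewrite /rate; field; rewrite a0.
have c0 : 2 * alpha * a 0%N ^+ 3 != 0 by rewrite a0_cube; apply: expf_neq0.
have r2 : 2 * alpha * a 0%N * rate ^+ 2 = 1.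
  apply: (mulfI c0); rewrite mulr1 [RHS]a0_cube rb; ring.
have gn0 : a 0%N ^+ 2 * (rate * rate ^+ n) != 0.
  by apply: mulf_neq0; [|apply: mulf_neq0]; rewrite ?expf_neq0.
rewrite {1}rb => eq; apply: (mulfI gn0).
have -> : a 0%N ^+ 2 * (rate * rate ^+ n) * (2 * (d1 - d2)) =
  2 * (a 0%N * a 0%N * (rate * rate ^+ n) * d1
  - a 0%N * a 0%N * (rate * rate ^+ n) * d2) by ring.
by rewrite -eq -[LHS]mul1r -{1}r2; field.
Qed.
End Normalization.

(** * Divergence *)

(** From some index on, the ratio [(2 n^2 - 3) / 3] exceeds [1 / r^2]. *)
Lemma geometric_increasing (R : realType) (h : nat -> R) (r : R) : 0 < r ->
  (forall n, 0 < h n.+3 /\ (2 * n.+3%:R ^+ 2 - 3) * h n.+3 <= 3 * h n.+5) ->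
  exists N, forall j,
    h N.+3 * r ^+ N.+3 <= h (N + j.*2).+3 * r ^+ (N + j.*2).+3.
Proof.
move=> r0 hh; pose N := Num.bound (3 / r ^+ 2).
have r20 : 0 < r ^+ 2 by exact: exprn_gt0.
have NP : 3 / r ^+ 2 < N%:R.
  by apply: archi_boundP; apply: divr_ge0 => //; exact: ltW.
rewrite ltr_pdivrMr // in NP; clearbody N.
exists N; elim=> [|j IHj]; first by rewrite addn0.
apply: (le_trans IHj); rewrite doubleS !addnS !exprS.
set m := (N + j.*2)%N; have [hm hm5] := hh m.
have rm : 0 < r * (r * (r * r ^+ m)) by rewrite !mulr_gt0 ?exprn_gt0.
have Nm : N%:R <= m%:R :> R by rewrite ler_nat leq_addr.
have N0 : 0 <= N%:R :> R by [].
suff : 3 * h m.+3 <= 3 * h m.+5 * r ^+ 2.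
  rewrite expr2 => H; have := ler_wpM2r (ltW rm) H; lra.
apply: (le_trans (y := (2 * m.+3%:R ^+ 2 - 3) * h m.+3 * r ^+ 2)).
  rewrite mulrAC; apply: ler_wpM2r; first exact: ltW.
  apply: (le_trans (ltW NP)); apply: ler_wpM2r; first exact: ltW.
  rewrite -(addn3 m) natrD; nra.
by apply: ler_wpM2r => //; exact: ltW.
Qed.

Lemma diverges_of_norm_ge (R : realType) (u : nat -> R[i]) (c : R[i]) N :
  0 < c -> (forall j, c <= `|u (N + j.*2)%N|) -> ~ cvg_complex_series u.
Proof.
move=> c0 cu /cvg_series_cvg_0 /cvgr0_norm_lt /(_ c c0) [M _ HM].
have lt_uc := HM (N + M.*2)%N ltac:(rewrite /=; lia).
by have := le_lt_trans (cu M) lt_uc; rewrite ltxx.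
Qed.

Theorem corollary3 (R : realType) (alpha beta delta : R[i]) (a : nat -> R[i])
  (h_alpha_beta : alpha * beta != 0)
  (h_delta : delta = - (beta ^+ 2 / 2))
  (h_a0 : a 0%N ^+ 3 = - delta / alpha)
  (h_a1 : a 1%N = - (beta / (2 * alpha * a 0%N)))
  (h_a2 : a 2%N = 0)
  (h_a3 : a 3%N = - (beta / (6 * alpha ^+ 2 * a 0%N ^+ 2))
                    * (beta ^+ 2 / (4 * delta) + 1))
  (h_an : forall n : nat, (4 <= n)%N ->
    a n = 1 / (3 * alpha * a 0%N ^+ 2) *
      (- alpha * (\sum_(1 <= k < n)
          a k * \sum_(0 <= j < (n - k).+1) a j * a (n - k - j)%N)
       - alpha * a 0%N * (\sum_(1 <= k < n) a k * a (n - k)%N)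
       - 3 / 2 * beta * a (n - 1)%N
       + \sum_(1 <= k < (n - 1)%N)
          (2 * k%:R ^+ 2 + k%:R * (2 - n%:R)) * a k * a (n - 2 - k)%N)) :
  forall x : R[i], x != 0 ->
    ~ cvg_complex_series (fun n : nat => a n * x ^- n).
Proof.
move=> x x0.
(* The coefficients of [h] in [w = 1 - s - h]. *)
pose H n : R[i] := (n == 0%N)%:R - (n == 1%N)%:R - normalized alpha beta a n.
have nE := normalizedE h_alpha_beta h_delta h_a0.
have a0 := a0_neq0 h_alpha_beta h_delta h_a0.
have g0 := rate_neq0 h_alpha_beta h_delta h_a0.
have HE n : excess_eq H n.
  apply: (@painleve_excess _ (normalized alpha beta a)).
    by move=> i; rewrite /H; ring.
  exact: (@normalized_painleve _ alpha beta delta).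
have H_lt3 i : (i < 3)%N -> H i = 0.
  case: i => [|[|[|//]]] _; rewrite /H /normalized.
  - by rewrite /= expr0 mulr1 divff // subr0 subrr.
  - rewrite h_a1 /rate expr1 /=; field.
    by rewrite a0 (alpha_neq0 h_alpha_beta) (beta_neq0 h_alpha_beta).
  - by rewrite h_a2 mul0r !subr0.
have [h Hh] := real_solution H_lt3 HE.
have h_lt3 i : (i < 3)%N -> h i = 0.
  move=> i3; apply: complexI.
  by rewrite -[LHS]/((real_complex R \o h) i) -Hh H_lt3.
have hE n : excess_eq h n.
  by apply: (@excess_eq_rmorph _ _ (real_complex R)); rewrite -Hh.
pose y := rate alpha beta a / x.
pose r := complex.Re `|y|.
have rE : (r%:C)%C = `|y| by rewrite /r RRe_real // normr_real.
have r0 : 0 < r.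
  by rewrite -ltcR rE normr_gt0 mulf_neq0 // invr_neq0.
have [N hN] := geometric_increasing r0 (coef_growth h_lt3 hE).
have uE n : `|a n.+3 * x ^- n.+3| = `|a 0%N| * (h n.+3 * r ^+ n.+3)%:C%C.
  have [h3 _] := coef_growth h_lt3 hE n.
  have -> : a n.+3 * x ^- n.+3 = - (a 0%N * (H n.+3 * y ^+ n.+3)).
    have -> : H n.+3 = - normalized alpha beta a n.+3 by rewrite /H subr0 sub0r.
    have -> : y ^+ n.+3 = rate alpha beta a ^+ n.+3 / x ^+ n.+3.
      exact: expr_div_n.
    rewrite nE.
    have signs (b G W X : R[i]) : b * G * W * X = - (b * (- W * (G * X))) by ring.
    exact: signs.
  rewrite normrN normrM (normrM (H n.+3)) (normrX _ y) -rE.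
  rewrite rmorphM rmorphXn; congr (_ * (_ * _)).
  by rewrite Hh /= ger0_norm // lecR ltW.
apply: (diverges_of_norm_ge (N := N.+3)
  (c := `|a 0%N| * (h N.+3 * r ^+ N.+3)%:C%C)).
  have [h3 _] := coef_growth h_lt3 hE N.
  by rewrite mulr_gt0 ?normr_gt0 // ltcR mulr_gt0 ?exprn_gt0.
by move=> j; rewrite !addSn uE ler_pM2l ?normr_gt0 // lecR.
Qed.
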